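(* There exist a function $f \in C^1[0,1]$ and a closed set $M \subset \operatorname{graph} f$ which is nowhere dense in $\operatorname{graph} f$ such that there does not exist any linearly continuous function $g:\mathbb{R}^2 \to \mathbb{R}$ which is discontinuous at each point of $M$.
   Context: $C^1[0,1]$ is the set of all $C^1$-smooth real functions on $[0,1]$ (with one-sided derivatives at the endpoints), and $\operatorname{graph} f=\{(x,f(x)): x\in[0,1]\}\subset\mathbb{R}^2$ is equipped with the subspace topology. A function $g:\mathbb{R}^2\to\mathbb{R}$ is called linearly continuous if its restriction to every (affine) line in $\mathbb{R}^2$ is continuous. Discontinuity of $g$ at a point refers to the usual topology of $\mathbb{R}^2$. *)

(* Defs.v *)
From mathcomp Require Import all_boot all_order all_algebra.
From mathcomp Require Import all_classical all_reals all_analysis.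

Set Implicit Arguments.
Unset Strict Implicit.
Unset Printing Implicit Defensive.

Import Order.TTheory GRing.Theory Num.Theory.
Import numFieldNormedType.Exports.

Local Open Scope classical_set_scope.
Local Open Scope ring_scope.

(* A function on [a, b] is represented by a total function f : R -> R; only its
   values on [a, b] matter.  The derivative is one-sided at both endpoints. *)
Definition C1_itv (R : realType) (a b : R) (f : R -> R) : Prop :=
  exists df : R -> R,
    [/\ {within `[a, b], continuous df},
        forall x : R, a < x < b -> is_derive x 1 f (df x),
        h^-1 * (f (a + h) - f a) @[h --> 0^'+] --> df a &
        h^-1 * (f (b + h) - f b) @[h --> 0^'-] --> df b].

Definition graph_on (R : realType) (A : set R) (f : R -> R) : set (R * R) :=
  [set (x, f x) | x in A].

Definition nowhere_dense (T : topologicalType) (S : set T) : Prop :=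
  interior (closure S) = set0.

(* In [subspace A] the points outside A are isolated, so for S included in A
   this is nowhere density for the topology induced on A. *)
Definition nowhere_dense_in (T : topologicalType) (A S : set T) : Prop :=
  @nowhere_dense (subspace A) S.

Definition affine_line (R : realType) (p v : R * R) : set (R * R) :=
  [set (p.1 + t * v.1, p.2 + t * v.2) | t in [set: R]].

Definition linearly_continuous (R : realType) (g : R * R -> R) : Prop :=
  forall p v : R * R, v != (0, 0) -> {within affine_line p v, continuous g}.

(* Main.v *)
Require Import Defs.
From mathcomp Require Import all_boot all_order all_algebra.
From mathcomp Require Import all_classical all_reals all_analysis.
From mathcomp Require Import ring lra.
Import Order.TTheory GRing.Theory Num.Theory.
Import numFieldNormedType.Exports.
Local Open Scope classical_set_scope.
Local Open Scope ring_scope.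

(* Let u be a continuous devil's staircase that is locally constant off a closed
   nowhere dense set K but not monotone near any point of K, let f' = u, and let
   M be the graph of f over K.  Since u is constant on the gaps of K, the tangents
   to the graph at points of K are all its tangents; since f is neither convex nor
   concave near any point of K, the tangents at points of K in an arbitrarily
   small interval I cover a neighbourhood of some point (z, f z) with z in K and I.

   Let g be linearly continuous and discontinuous at each point of M.  By
   continuity along tangents and Baire's theorem on K, there are eps > 0, c, a
   length l and an interval I meeting K such that, for a dense set of p in K and
   I, g oscillates by at least eps at (p, f p) while |g - c| < eps/4 on the tangent
   segment of length l at p.  By continuity of g along vertical lines,
   |g - c| <= eps/4 on all tangents at points of K close to I, hence on a
   neighbourhood of a point of M over I, which contradicts the oscillation. *)

(** * Geometric error bounds and the construction of the staircase *)

Lemma geometric_small (R : realType) (c e : R) :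
  0 < e -> exists n : nat, c * (2 / 3) ^+ n < e.
Proof.
move=> e0.
have h : (fun n : nat => c * (2 / 3) ^+ n) @ \oo --> (0 : R).
  by apply: (@cvg_geometric R c (2/3)); rewrite ger0_norm; lra.
have /cvgrPdist_lt/(_ _ e0) [N _ /(_ N (leqnn N))] /= := h.
by rewrite sub0r normrN => hN; exists N; exact: le_lt_trans (ler_norm _) hN.
Qed.

Lemma le0_geometric (R : realType) (c a : R) :
  (forall n : nat, a <= c * (2 / 3) ^+ n) -> a <= 0.
Proof.
move=> h; rewrite leNgt; apply/negP => a0.
by have [n] := @geometric_small R c a a0; rewrite ltNge h.
Qed.

Lemma eq0_geometric (R : realType) (c a : R) :
  (forall n : nat, `|a| <= c * (2 / 3) ^+ n) -> a = 0.
Proof. by move=> h; apply/eqP; rewrite -normr_le0; exact: le0_geometric h. Qed.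

(* If u = 0 left of 0 and u = 1 right of 1, at each point at most one of the
   three terms is not constant: the new graph climbs from 0 to 2/3 on [0, 1/5],
   descends to 1/3 on [2/5, 3/5] and climbs to 1 on [4/5, 1], each time along a
   copy of u, and is constant elsewhere. *)
Definition updownup (R : realType) (u : R -> R) (x : R) : R :=
  2 / 3 * u (5 * x) - 1 / 3 * u (5 * x - 2) + 2 / 3 * u (5 * x - 4).

Definition staircase_step (R : realType) (n : nat) : R -> R :=
  iter n (@updownup R) (fun x => Num.max 0 (Num.min 1 x)).

(** This is the uniform limit of the steps. The margin [3 * (2 / 3) ^+ n] is the tail of the
    geometric series of ratio 2/3 from rank n, so the upper bounds decrease to the limit and an
    infimum can stand for it. *)
Definition staircase (R : realType) (x : R) : R :=
  inf [set staircase_step R n x + 3 * (2 / 3) ^+ n | n in [set: nat]].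

Lemma staircase_step_le0 (R : realType) (n : nat) (x : R) :
  x <= 0 -> staircase_step R n x = 0.
Proof.
elim: n x => [|n IH] x x0 /=.
  by rewrite min_r ?max_l//; lra.
by rewrite /updownup !IH; lra.
Qed.

Lemma staircase_step_ge1 (R : realType) (n : nat) (x : R) :
  1 <= x -> staircase_step R n x = 1.
Proof.
elim: n x => [|n IH] x x0 /=.
  by rewrite min_l// max_r//; lra.
by rewrite /updownup !IH; lra.
Qed.

Lemma staircase_step_itv (R : realType) (n : nat) (x : R) :
  0 <= staircase_step R n x <= 1.
Proof.
elim: n x => [|n IH] x /=.
  rewrite le_max lexx/= ge_max ler01/=.
  by rewrite ge_min lexx.
rewrite /updownup; have := IH (5 * x); have := IH (5 * x - 2); have := IH (5 * x - 4).
have [x1|x1] := leP x (2/5).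
  rewrite (staircase_step_le0 R n (5 * x - 2)) ?(staircase_step_le0 R n (5 * x - 4)); lra.
rewrite (staircase_step_ge1 R n (5 * x)); last by lra.
have [x2|x2] := leP x (4/5).
  by rewrite (staircase_step_le0 R n (5 * x - 4)); lra.
by rewrite (staircase_step_ge1 R n (5 * x - 2)); lra.
Qed.

(** [updownup] contracts uniform distances by 2/3 on functions that are 0 left of 0 and 1 right of
    1: only its first term varies left of 2/5, only the second between 2/5 and 4/5, only the third
    beyond. *)
Lemma staircase_step_dist (R : realType) (n : nat) (x : R) :
  `|staircase_step R n.+1 x - staircase_step R n x| <= (2 / 3) ^+ n.
Proof.
elim: n x => [|n IH] x.
  have := staircase_step_itv R 0 x; have := staircase_step_itv R 1 x.
  rewrite expr0 ler_norml; lra.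
have step m y : staircase_step R m.+1 y = updownup R (staircase_step R m) y by [].
rewrite step (step n) /updownup exprS.
have := IH (5 * x); have := IH (5 * x - 2); have := IH (5 * x - 4).
have := exprn_ge0 n (_ : 0 <= 2 / 3 :> R).
set e := (2 / 3) ^+ n.
rewrite !ler_norml => /(_ ltac:(lra)) e0.
have [x1|x1] := leP x (2/5).
  rewrite !(staircase_step_le0 R _ (5 * x - 2)) ?(staircase_step_le0 R _ (5 * x - 4)); lra.
rewrite !(staircase_step_ge1 R _ (5 * x)); [|lra|lra].
have [x2|x2] := leP x (4/5).
  by rewrite !(staircase_step_le0 R _ (5 * x - 4)); lra.
by rewrite !(staircase_step_ge1 R _ (5 * x - 2)); lra.
Qed.

(** By the previous bound, the steps decrease once the margin is added and increase once it is
    subtracted; both sides are compared at rank [maxn n m]. *)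
Lemma staircase_step_cauchy (R : realType) (n m : nat) (x : R) :
  staircase_step R n x - 3 * (2 / 3) ^+ n
    <= staircase_step R m x + 3 * (2 / 3) ^+ m.
Proof.
pose u k := staircase_step R k x + 3 * (2 / 3) ^+ k.
pose v k := staircase_step R k x - 3 * (2 / 3) ^+ k.
have e0 k : 0 <= (2 / 3) ^+ k :> R by apply: exprn_ge0; lra.
have du : nonincreasing_seq u.
  apply/nonincreasing_seqP => k; rewrite /u exprS.
  have := staircase_step_dist R k x; rewrite ler_norml; lra.
have dv : nondecreasing_seq v.
  apply/nondecreasing_seqP => k; rewrite /v exprS.
  have := staircase_step_dist R k x; rewrite ler_norml; lra.
have := du _ _ (leq_maxr n m); have := dv _ _ (leq_maxl n m).
rewrite /u /v; have := e0 (maxn n m); lra.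
Qed.

Lemma staircase_approx (R : realType) (n : nat) (x : R) :
  `|staircase R x - staircase_step R n x| <= 3 * (2 / 3) ^+ n.
Proof.
set A := [set staircase_step R n x + 3 * (2 / 3) ^+ n | n in [set: nat]].
have lbA m : lbound A (staircase_step R m x - 3 * (2 / 3) ^+ m).
  by move=> _ [k _ <-]; exact: staircase_step_cauchy.
have infA : has_inf A.
  by split; [eexists; exists 0%N|exists (staircase_step R 0 x - 3 * (2 / 3) ^+ 0)].
have h1 : inf A <= staircase_step R n x + 3 * (2 / 3) ^+ n.
  by apply: ge_inf; [exact: infA.2|exists n].
have h2 : staircase_step R n x - 3 * (2 / 3) ^+ n <= inf A.
  by apply: lb_le_inf; [exact: infA.1|exact: lbA].
rewrite ler_norml /staircase -/A; lra.
Qed.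

Lemma staircase_le0 (R : realType) (x : R) : x <= 0 -> staircase R x = 0.
Proof.
move=> x0; apply: (@eq0_geometric R 3) => n.
by have := staircase_approx R n x; rewrite staircase_step_le0// subr0.
Qed.

Lemma staircase_ge1 (R : realType) (x : R) : 1 <= x -> staircase R x = 1.
Proof.
move=> x0; apply/eqP; rewrite -subr_eq0; apply/eqP.
apply: (@eq0_geometric R 3) => n.
by have := staircase_approx R n x; rewrite staircase_step_ge1.
Qed.

Lemma staircase_ge0 (R : realType) (x : R) : 0 <= staircase R x.
Proof.
rewrite -oppr_le0; apply: (@le0_geometric R 3) => n.
have := staircase_approx R n x; have := staircase_step_itv R n x.
rewrite ler_norml; lra.
Qed.

Lemma staircase_le1 (R : realType) (x : R) : staircase R x <= 1.
Proof.
rewrite -subr_le0; apply: (@le0_geometric R 3) => n.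
have := staircase_approx R n x; have := staircase_step_itv R n x.
rewrite ler_norml; lra.
Qed.

Lemma staircase_fixpoint (R : realType) (x : R) :
  staircase R x = updownup R (staircase R) x.
Proof.
apply/eqP; rewrite -subr_eq0; apply/eqP.
(* The step of rank n + 1 contributes 3 * 2/3 = 2, and the three terms of [updownup] contribute 3 *
   (2/3 + 1/3 + 2/3) = 5. *)
apply: (@eq0_geometric R 7) => n.
have := staircase_approx R n.+1 x.
rewrite [staircase_step R n.+1 x]/= /updownup.
have := staircase_approx R n (5 * x).
have := staircase_approx R n (5 * x - 2).
have := staircase_approx R n (5 * x - 4).
have := exprn_ge0 n (_ : 0 <= 2 / 3 :> R).
rewrite exprS; set e := (2 / 3) ^+ n.
rewrite -/(staircase_step R n) !ler_norml => /(_ ltac:(lra)); lra.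
Qed.

Lemma staircase_step_continuous (R : realType) (n : nat) :
  continuous (staircase_step R n).
Proof.
elim: n => [|n IH] /= x.
  apply: (@continuous_max R R (cst 0) (fun y => Num.min 1 y)); first exact: cvg_cst.
  apply: (@continuous_min R R (cst 1) id); [exact: cvg_cst|exact: cvg_id].
have cc (a : R) : {for x, continuous (fun y : R => staircase_step R n (5 * y - a))}.
  apply: (@continuous_comp _ _ _ (fun y : R => 5 * y - a)); last exact: IH.
  apply: cvgB; last exact: cvg_cst.
  by apply: cvgM; [exact: cvg_cst|exact: cvg_id].
have cc0 : {for x, continuous (fun y : R => staircase_step R n (5 * y))}.
  have -> : (fun y : R => staircase_step R n (5 * y)) =
    (fun y : R => staircase_step R n (5 * y - 0)) by apply/funext => y; rewrite subr0.
  exact: cc.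
rewrite /updownup; apply: cvgD; first apply: cvgB.
- by apply: cvgM; [exact: cvg_cst|exact: cc0].
- by apply: cvgM; [exact: cvg_cst|exact: cc].
- by apply: cvgM; [exact: cvg_cst|exact: cc].
Qed.

Lemma staircase_continuous (R : realType) : continuous (staircase R).
Proof.
move=> x; apply/cvgrPdist_lt => e e0.
have [n ne] := @geometric_small R 3 (e / 3) (divr_gt0 e0 (ltr0Sn _ 2)).
have /cvgrPdist_lt/(_ (e / 3) (divr_gt0 e0 (ltr0Sn _ 2))) :=
  staircase_step_continuous R n x.
apply: filterS => y; have := staircase_approx R n x; have := staircase_approx R n y.
rewrite !ler_norml !ltr_norml; lra.
Qed.

(** * Self-similarity: the two ascending branches, the descending one and a plateau *)

Lemma staircase_first (R : realType) (t : R) : 0 <= t <= 1 ->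
  staircase R (t / 5) = 2 / 3 * staircase R t.
Proof.
move=> t01; rewrite staircase_fixpoint /updownup.
rewrite (staircase_le0 R (5 * (t / 5) - 2)); last by lra.
rewrite (staircase_le0 R (5 * (t / 5) - 4)); last by lra.
have -> : 5 * (t / 5) = t by lra.
lra.
Qed.

Lemma staircase_second (R : realType) (t : R) : 0 <= t <= 1 ->
  staircase R ((2 + t) / 5) = 2 / 3 - 1 / 3 * staircase R t.
Proof.
move=> t01; rewrite staircase_fixpoint /updownup.
rewrite (staircase_ge1 R (5 * ((2 + t) / 5))); last by lra.
rewrite (staircase_le0 R (5 * ((2 + t) / 5) - 4)); last by lra.
have -> : 5 * ((2 + t) / 5) - 2 = t by lra.
lra.
Qed.

Lemma staircase_third (R : realType) (t : R) : 0 <= t <= 1 ->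
  staircase R ((4 + t) / 5) = 1 / 3 + 2 / 3 * staircase R t.
Proof.
move=> t01; rewrite staircase_fixpoint /updownup.
rewrite (staircase_ge1 R (5 * ((4 + t) / 5))); last by lra.
rewrite (staircase_ge1 R (5 * ((4 + t) / 5) - 2)); last by lra.
have -> : 5 * ((4 + t) / 5) - 4 = t by lra.
lra.
Qed.

Lemma staircase_plateau (R : realType) (t : R) : 1 / 5 <= t <= 2 / 5 ->
  staircase R t = 2 / 3.
Proof.
move=> ht; rewrite staircase_fixpoint /updownup.
rewrite (staircase_ge1 R (5 * t)); last by lra.
rewrite (staircase_le0 R (5 * t - 2)); last by lra.
rewrite (staircase_le0 R (5 * t - 4)); last by lra.
lra.
Qed.

(** * The variation set of the staircase and the small copies around its points *)

Definition locally_constant_at (R : realType) (u : R -> R) (x : R) : Prop :=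
  exists2 e : R, 0 < e & forall t, `|t - x| < e -> u t = u x.

(** For the staircase this is the set K of the overview. Defined as a complement, it is closed for
    every [u], and off it the tangents to an antiderivative do not change locally. *)
Definition variation_set (R : realType) (u : R -> R) : set R :=
  [set x | ~ locally_constant_at R u x].

Lemma notin_variation_set (R : realType) (u : R -> R) (x : R) :
  ~ variation_set R u x -> locally_constant_at R u x.
Proof. by move/contrapT. Qed.

Lemma closed_variation_set (R : realType) (u : R -> R) :
  closed (variation_set R u).
Proof.
rewrite -[variation_set R u]setCK; apply: open_closedC.
rewrite openE => x /contrapT [e e0 he] /=.
apply/nbhs_ballP; exists (e / 2); first by rewrite /= divr_gt0.
move=> y; rewrite -ball_normE /= => xy; apply: contrapT; apply; rewrite notK.
exists (e / 2); first by rewrite divr_gt0.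
move=> t ty; rewrite he; first by rewrite he//; move: xy; rewrite !ltr_norml; lra.
move: xy ty; rewrite !ltr_norml; lra.
Qed.

Lemma variation_staircase_itv (R : realType) (x : R) :
  variation_set R (staircase R) x -> 0 <= x <= 1.
Proof.
move=> Kx; apply: contrapT => /negP; rewrite negb_and -!ltNge => /orP[x0|x1]; apply: Kx.
- exists (- x); first by lra.
  by move=> t; rewrite ltr_norml => tx; rewrite !staircase_le0//; lra.
- exists (x - 1); first by lra.
  by move=> t; rewrite ltr_norml => tx; rewrite !staircase_ge1//; lra.
Qed.

(** If the staircase were locally constant at all three rescaled points, the fixed point equation
    would make it locally constant at [x]. *)
Lemma variation_staircase_expand (R : realType) (x : R) :
  variation_set R (staircase R) x ->
  exists2 a : R, [\/ a = 0, a = 2 | a = 4] &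
    variation_set R (staircase R) (5 * x - a).
Proof.
move=> Kx; apply: contrapT => h; apply: Kx.
have lc a : [\/ a = 0, a = 2 | a = 4] ->
    locally_constant_at R (staircase R) (5 * x - a).
  by move=> ha; apply: notin_variation_set => Ka; apply: h; exists a.
have [e0 e0p h0] := lc 0 (Or31 _ _ erefl).
have [e1 e1p h1] := lc 2 (Or32 _ _ erefl).
have [e2 e2p h2] := lc 4 (Or33 _ _ erefl).
exists (Num.min e0 (Num.min e1 e2) / 5).
  by rewrite divr_gt0// !lt_min e0p e1p e2p.
move=> t; rewrite ltr_pdivlMr// !lt_min => /and3P[t0 t1 t2].
rewrite staircase_fixpoint [RHS]staircase_fixpoint /updownup.
have n5 a : `|5 * t - a - (5 * x - a)| = `|t - x| * 5.
  have -> : 5 * t - a - (5 * x - a) = 5 * (t - x) by lra.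
  by rewrite normrM mulrC [`|5|]ger0_norm.
have := h0 (5 * t - 0); rewrite n5 !subr0 => /(_ t0) ->.
by rewrite (h1 (5 * t - 2)) ?n5// (h2 (5 * t - 4)) ?n5.
Qed.

(** An affine copy of the graph over the unit interval lies above [s, s + r]. The factor [b] may be
    negative, since each passage through the descending branch turns the copy upside down. *)
Definition staircase_copy (R : realType) (s r a b : R) : Prop :=
  [/\ 0 <= s, 0 < r, s + r <= 1, b != 0 &
      forall t, 0 <= t <= 1 -> staircase R (s + r * t) = a + b * staircase R t].

(** By induction, a copy around the expanded point [5 * x - c] is carried back to [x] by the branch
    belonging to [c], which shrinks it by 1/5. *)
Lemma variation_staircase_copy (R : realType) (n : nat) (x : R) :
  variation_set R (staircase R) x ->
  exists s a b : R, staircase_copy R s ((1 / 5) ^+ n) a b /\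
    s <= x <= s + (1 / 5) ^+ n.
Proof.
elim: n x => [|n IH] x Kx.
  exists 0, 0, 1; rewrite expr0; split; last by have := variation_staircase_itv R x Kx; lra.
  by split=> //; rewrite ?add0r// ?oner_eq0// => t _; rewrite add0r !mul1r add0r.
have [c hc Kc] := variation_staircase_expand R x Kx.
have [s [a [b [[s0 r0 s1 b0 hs] xs]]]] := IH _ Kc.
rewrite exprS; set r := (1 / 5) ^+ n in r0 s1 hs xs *.
have in01 (t : R) : 0 <= t <= 1 -> 0 <= s + r * t <= 1.
  move=> t01; have := mulr_ge0 (ltW r0) (proj1 (andP t01)).
  have : r * t <= r * 1 by apply: ler_wpM2l; lra.
  lra.
case: hc xs => -> xs.
- exists (s / 5), (2 / 3 * a), (2 / 3 * b); split; last by lra.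
  split; [lra|lra|lra|by apply: mulf_neq0 => //; lra|move=> t t01].
  have -> : s / 5 + 1 / 5 * r * t = (s + r * t) / 5 by lra.
  rewrite staircase_first; last exact: in01.
  by rewrite hs//; field.
- exists ((2 + s) / 5), (2 / 3 - 1 / 3 * a), (- (1 / 3) * b); split; last by lra.
  split; [lra|lra|lra|by apply: mulf_neq0 => //; lra|move=> t t01].
  have -> : (2 + s) / 5 + 1 / 5 * r * t = (2 + (s + r * t)) / 5 by lra.
  rewrite staircase_second; last exact: in01.
  by rewrite hs//; field.
- exists ((4 + s) / 5), (1 / 3 + 2 / 3 * a), (2 / 3 * b); split; last by lra.
  split; [lra|lra|lra|by apply: mulf_neq0 => //; lra|move=> t t01].
  have -> : (4 + s) / 5 + 1 / 5 * r * t = (4 + (s + r * t)) / 5 by lra.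
  rewrite staircase_third; last exact: in01.
  by rewrite hs//; field.
Qed.

Lemma variation_staircase_copy_lt (R : realType) (x e : R) :
  variation_set R (staircase R) x -> 0 < e ->
  exists s r a b : R, [/\ staircase_copy R s r a b, x - e < s & s + r < x + e].
Proof.
move=> Kx e0; have [n ne] := geometric_small R 1 e e0.
have [s [a [b [cp sx]]]] := variation_staircase_copy R n x Kx.
exists s, ((1 / 5) ^+ n), a, b; split => //.
all: have : (1 / 5) ^+ n <= (2 / 3) ^+ n :> R by apply: lerXn2r; rewrite ?nnegrE; lra.
all: lra.
Qed.

(** These points show that the staircase is not constant on any left neighbourhood of 1. *)
Lemma staircase_near1 (R : realType) (k : nat) :
  staircase R (1 - (1 / 5) ^+ k) = 1 - (2 / 3) ^+ k.
Proof.
elim: k => [|k IH]; first by rewrite !expr0 !subrr staircase_le0.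
have r01 : 0 <= (1 / 5 : R) ^+ k <= 1.
  by rewrite exprn_ge0 ?exprn_ile1//; lra.
rewrite !exprS; set r := (1 / 5) ^+ k in IH r01 *.
have -> : 1 - 1 / 5 * r = (4 + (1 - r)) / 5 by lra.
rewrite staircase_third ?IH; lra.
Qed.

(** The point 3/5 is the image of 1 under the descending branch; the images of the points 1 -
    (1/5)^k tend to it from the left with values different from its own. *)
Lemma staircase_copy_variation (R : realType) (s r a b : R) :
  staircase_copy R s r a b ->
  variation_set R (staircase R) (s + r * (3 / 5)).
Proof.
move=> [s0 r0 s1 b0 hs] [e e0 he].
have [k ke] := geometric_small R 1 e e0.
have r01 : 0 <= (1 / 5 : R) ^+ k <= 1.
  by rewrite exprn_ge0 ?exprn_ile1//; lra.
have le : (1 / 5) ^+ k <= (2 / 3) ^+ k :> R by apply: lerXn2r; rewrite ?nnegrE; lra.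
have := he (s + r * ((2 + (1 - (1 / 5) ^+ k)) / 5)).
have -> : s + r * ((2 + (1 - (1 / 5) ^+ k)) / 5) - (s + r * (3 / 5)) =
   - (r * ((1 / 5) ^+ k / 5)) by lra.
have rk : 0 <= r * ((1 / 5) ^+ k / 5) by apply: mulr_ge0; lra.
have rk1 : r * ((1 / 5) ^+ k / 5) <= 1 * ((1 / 5) ^+ k / 5) by apply: ler_wpM2r; lra.
rewrite normrN ger0_norm// => /(_ ltac:(lra)).
rewrite !hs; [|lra|lra].
rewrite staircase_second; last by lra.
have -> : 3 / 5 = (2 + 1) / 5 :> R by lra.
rewrite staircase_second; last by lra.
rewrite staircase_near1 staircase_ge1// => /addrI/(mulfI b0).
have := exprn_gt0 k (_ : 0 < 2 / 3 :> R) => /(_ ltac:(lra)); lra.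
Qed.

Lemma variation_staircase_neq0 (R : realType) :
  exists x, variation_set R (staircase R) x.
Proof.
exists (0 + 1 * (3 / 5)); apply: (@staircase_copy_variation R 0 1 0 1).
by split=> //; rewrite ?add0r// ?oner_eq0// => t _; rewrite add0r !mul1r add0r.
Qed.

Lemma variation_staircase_gap (R : realType) (x e : R) :
  variation_set R (staircase R) x -> 0 < e ->
  exists y, [/\ 0 <= y <= 1, `|y - x| < e & ~ variation_set R (staircase R) y].
Proof.
move=> Kx e0.
have [s [r [a [b [[s0 r0 s1 b0 hs] xs sx]]]]] := variation_staircase_copy_lt R x e Kx e0.
(* This is the midpoint of the plateau [1/5, 2/5] in a small copy; the plateau has half-width
   [r / 10] there. *)
exists (s + r * (3 / 10)); split; [lra|rewrite ltr_norml; lra|apply].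
have const t : 1 / 5 <= t <= 2 / 5 -> staircase R (s + r * t) = a + b * (2 / 3).
  by move=> t0; rewrite hs ?staircase_plateau//; lra.
exists (r / 10); first by lra.
move=> t; rewrite ltr_norml => ht; rewrite const; last by lra.
have -> : t = s + r * ((t - s) / r) by rewrite mulrC divfK ?gt_eqF//; lra.
by apply: const; rewrite ler_pdivlMr// ler_pdivrMr//; lra.
Qed.

(* Up to the factor c, in each copy of the staircase the value at its point 3/5
   lies strictly between those at its points 0 and 2/5, which are the minimum
   and the maximum of the copy of [0, 3/5]. *)
Lemma variation_staircase_turn (R : realType) (x e : R) :
  variation_set R (staircase R) x -> 0 < e ->
  exists p q z c : R, [/\ p < q < z,
    [/\ x - e < p, z < x + e & variation_set R (staircase R) z],
    c != 0,
    forall t, p <= t <= z -> c * staircase R p <= c * staircase R t <= c * staircase R q &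
    c * staircase R p < c * staircase R z < c * staircase R q].
Proof.
move=> Kx e0.
have [s [r [a [b [cp xs sx]]]]] := variation_staircase_copy_lt R x e Kx e0.
have Kz := staircase_copy_variation R s r a b cp.
have [s0 r0 s1 b0 hs] := cp.
(* Multiplying by [b^-1] undoes the vertical scaling, including a possible reflection. *)
exists s, (s + r * (2 / 5)), (s + r * (3 / 5)), b^-1.
have sE t : 0 <= t <= 1 -> b^-1 * staircase R (s + r * t) = b^-1 * a + staircase R t.
  by move=> t01; rewrite hs// mulrDr mulrA mulVf// mul1r.
have s0E : b^-1 * staircase R s = b^-1 * a.
  by rewrite -[in LHS](addr0 s) -(mulr0 r) sE ?staircase_le0//; lra.
have fE : staircase R (3 / 5) = 1 / 3.
  have -> : 3 / 5 = (2 + 1) / 5 :> R by lra.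
  by rewrite staircase_second ?staircase_ge1//; lra.
rewrite s0E sE; last by lra.
rewrite sE; last by lra.
rewrite fE (staircase_plateau R (2 / 5)); last by lra.
split; [lra|split=> //; lra|by rewrite invr_eq0| |lra].
move=> t tz.
have -> : t = s + r * ((t - s) / r) by rewrite mulrC divfK ?gt_eqF//; lra.
set w := (t - s) / r.
have w0 : 0 <= w by rewrite ler_pdivlMr//; lra.
have w1 : w <= 3 / 5 by rewrite ler_pdivrMr//; lra.
rewrite sE; last by lra.
have := staircase_ge0 R w.
suff : staircase R w <= 2 / 3 by lra.
have [wa|wa] := leP w (1 / 5).
  have -> : w = (5 * w) / 5 by lra.
  rewrite staircase_first; last by lra.
  by have := staircase_le1 R (5 * w); lra.
have [wb|wb] := leP w (2 / 5).
  by rewrite staircase_plateau; lra.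
have -> : w = (2 + (5 * w - 2)) / 5 by lra.
rewrite staircase_second; last by lra.
by have := staircase_ge0 R (5 * w - 2); lra.
Qed.

(** * Antiderivatives and their tangents *)

Lemma antiderivative (R : realType) (u : R -> R) :
  continuous u -> (forall x : R, x <= 0 -> u x = 0) ->
  exists f : R -> R, forall x : R, is_derive x 1 f (u x).
Proof.
move=> cu u0.
(* The fundamental theorem covers the points right of -1; at the others [f] is locally 0 because [u]
   vanishes left of 0. *)
pose f (x : R) : R := \int[lebesgue_measure]_(t in `[-1, x]) u t.
exists f => x; have [x1|x1] := ltP (-1) x.
  have iu : lebesgue_measure.-integrable `[-1, x + 1] (EFin \o u).
    apply: continuous_compact_integrable; first exact: segment_compact.
    exact: continuous_subspaceT.
  have xx1 : x < x + 1 by lra.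
  have [dfx fx] := continuous_FTC1_closed xx1 iu x1 (cu x).
  by apply: DeriveDef; [exact: dfx | rewrite -derive1E].
have f0 y : y <= 0 -> f y = 0.
  move=> y0; rewrite /f (@eq_Rintegral _ _ _ _ _ (fun=> 0)) ?Rintegral_cst ?mul0r//.
  move=> t; rewrite inE /= in_itv /= => /andP[_ ty]; rewrite u0//; lra.
rewrite u0; last by lra.
apply: (@near_eq_is_derive _ _ _ (cst 0)).
have x0 : x < 0 by lra.
by near=> y; rewrite f0//; near: y; exact: lt_le_nbhsl.
Unshelve. all: by end_near. Qed.

Lemma is_derive_C1_itv (R : realType) (a b : R) (f u : R -> R) :
  continuous u -> (forall x : R, is_derive x 1 f (u x)) -> C1_itv a b f.
Proof.
move=> cu df.
have lim0 x : h^-1 * (f (x + h) - f x) @[h --> 0^'] --> u x.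
  have [dfx ux] := df x.
  rewrite -ux; apply: cvg_trans dfx; apply: near_eq_cvg.
  by near=> h; rewrite /= /GRing.scale /= mulr1 [h + x]addrC.
exists u; split.
- exact: continuous_subspaceT.
- by move=> x _; exact: df.
- exact: cvg_dnbhs_at_right.
- exact: cvg_dnbhs_at_left.
Unshelve. all: by end_near. Qed.

Lemma is_derive_continuous (R : realType) (f u : R -> R) :
  (forall x : R, is_derive x 1 f (u x)) -> continuous f.
Proof.
by move=> df x; apply/differentiable_continuous/derivable1_diffP; have [] := df x.
Qed.

Lemma is_derive_within_continuous (R : realType) (f u : R -> R) (A : set R) :
  (forall x : R, is_derive x 1 f (u x)) -> {within A, continuous f}.
Proof. by move=> df; exact/continuous_subspaceT/(is_derive_continuous R f u). Qed.

(** The mean value theorem is applied on [p, s] and on [s, z], with [s] so close to [z] that [u]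
    exceeds [u p] on all of [s, z]: the first piece gives a weak inequality, the second a strict
    one. *)
Lemma tangent_lt (R : realType) (f u : R -> R) (p z : R) :
  continuous u -> (forall x : R, is_derive x 1 f (u x)) -> p < z ->
  (forall t, p <= t <= z -> u p <= u t) -> u p < u z ->
  f p + u p * (z - p) < f z.
Proof.
move=> cu df pz upt uz.
have /nbhs_ballP[e e0 he] : \forall t \near z, u p < u t.
  by exact: (cvgr_gt (u z) (cu z)).
pose s := Num.max ((p + z) / 2) (z - e / 2).
have ps : p < s by rewrite lt_max; apply/orP; left; lra.
have sz : s < z by rewrite gt_max; move: e0 => /=; lra.
have se : z - e / 2 <= s by rewrite le_max lexx orbT.
have [c1 c1s e1] := MVT ps (fun x _ => df x) (is_derive_within_continuous _ _ _ _ df).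
have [c2 c2s e2] := MVT sz (fun x _ => df x) (is_derive_within_continuous _ _ _ _ df).
move: c1s c2s; rewrite !in_itv /= => c1s c2s.
have h1 : u p * (s - p) <= u c1 * (s - p).
  by apply: ler_wpM2r; [lra|apply: upt; lra].
have h2 : u p * (z - s) < u c2 * (z - s).
  rewrite ltr_pM2r; last by lra.
  by apply: he; rewrite -ball_normE /= ltr_norml; move: e0 => /=; lra.
have -> : u p * (z - p) = u p * (s - p) + u p * (z - s) by ring.
lra.
Qed.

(** Where the slope is constant the graph is a straight segment, so all its tangents there are one
    line. *)
Lemma tangent_locally_constant (R : realType) (f u : R -> R) (x p : R) :
  (forall x : R, is_derive x 1 f (u x)) -> locally_constant_at R u p ->
  locally_constant_at R (fun q => f q + u q * (x - q)) p.
Proof.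
move=> df [e e0 he]; exists e => // t te; rewrite (he t te).
suff : f t - f p = u p * (t - p) by move=> h; rewrite -(subrK (f p) (f t)) h; ring.
have mvt a b : a < b -> `|a - p| < e -> `|b - p| < e -> f b - f a = u p * (b - a).
  move=> ab ae be.
  have [c] := MVT ab (fun x _ => df x) (is_derive_within_continuous _ _ _ _ df).
  rewrite in_itv /= => cab ->; rewrite he//.
  by move: ae be; rewrite !ltr_norml; lra.
have [tp|pt|->] := ltgtP t p.
- by have := mvt _ _ tp te; rewrite subrr normr0 => /(_ e0); lra.
- by apply: mvt => //; rewrite subrr normr0.
- by rewrite !subrr mulr0.
Qed.

(* The first time h takes the value y cannot be a point of local constancy. *)
Lemma IVT_variation (R : realType) (h : R -> R) (K : set R) (p q y : R) :
  continuous h -> (forall x, ~ K x -> locally_constant_at R h x) ->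
  p < q -> h p < y < h q ->
  exists2 x, p <= x <= q & K x /\ h x = y.
Proof.
move=> ch hK pq /andP[hp hq].
pose S := [set t | p <= t <= q /\ y <= h t].
have Sq : S q by split; [lra|exact: ltW].
have lbS : lbound S p by move=> t [/andP[]].
have hinf : has_inf S by split; [exists q|exists p].
pose x := inf S.
have px : p <= x by apply: lb_le_inf; [exists q|].
have xq : x <= q by apply: ge_inf; [exists p|].
have below t : p <= t < x -> h t < y.
  move=> ptx; rewrite ltNge; apply/negP => yt.
  have : x <= t by apply: ge_inf; [exists p|split=> //; lra].
  lra.
have yx : y <= h x.
  rewrite leNgt; apply/negP => hx.
  have /nbhs_ballP[e e0 he] : \forall t \near x, h t < y.
    by exact: (cvgr_lt (h x) (ch x)).
  have [s [psq ys] sx] := inf_adherent e0 hinf.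
  have xs : x <= s by apply: ge_inf; [exists p|].
  have : h s < y by apply: he; rewrite -ball_normE /= ltr_norml /x in xs sx *; lra.
  lra.
have px' : p < x.
  by rewrite lt_neqAle px andbT; apply/eqP => pE; move: yx; rewrite -pE; lra.
have hxy : h x = y.
  apply/eqP; rewrite eq_le yx andbT leNgt; apply/negP => hx.
  have /nbhs_ballP[e e0 he] : \forall t \near x, y < h t.
    by exact: (cvgr_gt (h x) (ch x)).
  pose s := Num.max p (x - e / 2).
  move: e0 => /= e0.
  have sp : p <= s by rewrite le_max lexx.
  have sx : s < x by rewrite gt_max px'; lra.
  have se : x - e / 2 <= s by rewrite le_max lexx orbT.
  have := below s (introT andP (conj sp sx)).
  suff : y < h s by lra.
  by apply: he; rewrite -ball_normE /= ltr_norml; lra.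
exists x; first by lra.
split => //; apply: contrapT => /hK [e e0 he].
pose s := Num.max p (x - e / 2).
have sp : p <= s by rewrite le_max lexx.
have sx : s < x by rewrite gt_max px'; lra.
have se : x - e / 2 <= s by rewrite le_max lexx orbT.
have := below s (introT andP (conj sp sx)).
by rewrite he ?hxy ?ltxx// ltr_norml; lra.
Qed.

(** * Baire's theorem on a closed set of reals, and covering by tangents *)

Lemma nested_balls_limit (R : realType) (x r : nat -> R) :
  (forall n, 0 <= r n) ->
  (forall n, `|x n.+1 - x n| + r n.+1 <= r n) ->
  exists l, forall n, `|l - x n| <= r n.
Proof.
move=> r0 xr.
have h n : x n - r n <= x n.+1 - r n.+1 /\ x n.+1 + r n.+1 <= x n + r n.
  have := xr n; have := ler_norm (x n.+1 - x n); have := ler_norm (- (x n.+1 - x n)).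
  rewrite normrN; lra.
have dl : nondecreasing_seq (fun n => x n - r n).
  by apply/nondecreasing_seqP => n; have [] := h n.
have du : nonincreasing_seq (fun n => x n + r n).
  by apply/nonincreasing_seqP => n; have [] := h n.
have lu n m : x n - r n <= x m + r m.
  have /= := dl _ _ (leq_maxl n m); have /= := du _ _ (leq_maxr n m).
  have := r0 (maxn n m); lra.
pose S := [set x n - r n | n in [set: nat]].
have hS : has_sup S.
  by split; [exists (x 0%N - r 0%N), 0%N|exists (x 0%N + r 0%N) => _ [n _ <-]].
exists (sup S) => n.
have h1 : x n - r n <= sup S by apply: ub_le_sup; [exact: hS.2|exists n].
have h2 : sup S <= x n + r n.
  by apply: ge_sup; [exact: hS.1|move=> _ [m _ <-]].
rewrite ler_norml; lra.
Qed.

(** If no [A i] were dense in a portion of [K], nested balls centred in [K] could avoid the sets one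
    after another, and their common point would lie in [K] but in no [A i]. *)
Lemma closed_baire (R : realType) (I : countType) (K : set R) (A : I -> set R) :
  closed K -> K !=set0 -> (forall x, K x -> exists i, A i x) ->
  exists (i : I) (x e : R), [/\ K x, 0 < e &
    forall y d, K y -> `|y - x| < e -> 0 < d -> exists2 a, A i a & `|a - y| < d].
Proof.
move=> cK [x0 Kx0] KA; apply: contrapT => nA.
have shrink (i : I) (x e : R) : K x -> 0 < e -> exists y d : R,
    [/\ K y, `|y - x| < e, 0 < d & forall a, A i a -> d <= `|a - y|].
  move=> Kx e0; apply: contrapT => h; apply: nA; exists i, x, e; split => //.
  move=> y d Ky yx d0; apply: contrapT => h'; apply: h; exists y, d; split => //.
  by move=> a Aa; rewrite leNgt; apply/negP => ad; apply: h'; exists a.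
(* A pair is a centre and a radius. Stage n avoids the set whose index has code n, if there is one;
   the premises sit under the existential so that a choice can be made for every pair. *)
have step (n : nat) (s : R * R) : exists s' : R * R, K s.1 -> 0 < s.2 ->
    [/\ K s'.1, 0 < s'.2, `|s'.1 - s.1| + s'.2 <= s.2, s'.2 <= 2 / 3 * s.2 &
     forall i a, unpickle n = Some i -> A i a -> s'.2 < `|a - s'.1|].
  have [[Ks s0]|] := pselect (K s.1 /\ 0 < s.2); last by move=> h; exists s => Ks s0; case: h.
  case En : (unpickle n) => [i|]; last first.
    by exists (s.1, s.2 / 2) => _ _; split=> //=; rewrite ?subrr ?normr0; lra.
  have [y [d [Ky ys d0 hd]]] := shrink i s.1 (s.2 / 2) Ks ltac:(lra).
  (* Half of [d] keeps the closed ball off [A i], half of the old radius keeps it inside the old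
     ball. *)
  exists (y, Num.min (d / 2) (s.2 / 2)) => _ _ /=.
  have m1 : Num.min (d / 2) (s.2 / 2) <= d / 2 by rewrite ge_min lexx.
  have m2 : Num.min (d / 2) (s.2 / 2) <= s.2 / 2 by rewrite ge_min lexx orbT.
  split=> //; [by rewrite lt_min; lra|lra|lra|].
  by move=> j a [<-] /hd; lra.
pose next n s := projT1 (cid (step n s)).
pose s := fix s n := if n is m.+1 then next m (s m) else (x0, 1).
have sK n : K (s n).1 /\ 0 < (s n).2.
  elim: n => [|n [K1 s1]]; first by split.
  by have [] := projT2 (cid (step n (s n))) K1 s1.
have sS n := projT2 (cid (step n (s n))) (sK n).1 (sK n).2.
have [l hl] : exists l, forall n, `|l - (s n).1| <= (s n).2.
  apply: nested_balls_limit => n; first by have [_ /ltW] := sK n.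
  by have [] := sS n.
have s_small n : (s n).2 <= 1 * (2 / 3) ^+ n.
  elim: n => [|n IH]; first by rewrite expr0 mulr1.
  have [_ _ _] := sS n; rewrite exprS -/(next n (s n)) /= => h _.
  by apply: le_trans h _; lra.
have Kl : K l.
  rewrite (closure_id K).1//; move=> B /nbhs_ballP[e /= e0 eB].
  have [n ne] := geometric_small R 1 e e0.
  exists (s n).1; split; first exact: (sK n).1.
  by apply: eB; rewrite -ball_normE /=; apply: le_lt_trans (hl n) _; have := s_small n; lra.
have [i Ail] := KA l Kl.
have [_ _ _ _ /(_ i l (pickleK i) Ail)] := sS (pickle i).
by rewrite ltNge => /negP; apply; exact: hl (pickle i).+1.
Qed.

(* The tangents at p and q pass on opposite sides of (z, f z).  The height over t
   of the tangent at s is a continuous function of s, locally constant off the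
   variation set of the slope, so it takes each intermediate value at a point of
   that set. *)
Lemma staircase_tangents_cover (R : realType) (f : R -> R) (x e : R) :
  (forall x : R, is_derive x 1 f (staircase R x)) ->
  variation_set R (staircase R) x -> 0 < e ->
  exists z d : R, [/\ variation_set R (staircase R) z, `|z - x| < e, 0 < d &
    forall t y, `|t - z| < d -> `|y - f z| < d ->
      exists q, [/\ variation_set R (staircase R) q, `|q - x| < e &
        f q + staircase R q * (t - q) = y]].
Proof.
move=> df Kx e0.
have [p [q [z [c [/andP[pq qz] [xp zx Kz] c0 hc uc]]]]] :=
  variation_staircase_turn R x e Kx e0.
set u := staircase R in df Kx Kz hc uc *.
have cu : continuous u := staircase_continuous R.
have cfu a : continuous (fun x => a * u x) by move=> y; apply: cvgM; [exact: cvg_cst|exact: cu].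
have dfu a (y : R) : is_derive y 1 (fun x => a * f x) (a * u y) by exact: is_deriveZ.
have lt1 : c * f p + c * u p * (z - p) < c * f z.
  apply: (@tangent_lt R (fun x => c * f x) (fun x => c * u x)) => //; [lra| |lra].
  by move=> t /hc; lra.
have lt2 : c * f z < c * f q + c * u q * (z - q).
  have := @tangent_lt R (fun x => - c * f x) (fun x => - c * u x) q z (cfu _) (dfu _) qz.
  suff: (forall t : R, q <= t <= z -> - c * u q <= - c * u t) /\ - c * u q < - c * u z.
    by move=> [h1 h2] /(_ h1 h2); rewrite !mulNr; lra.
  split; last by rewrite !mulNr; lra.
  by move=> t tz; have := hc t ltac:(lra); rewrite !mulNr; lra.
(* The smaller of the margins by which the two tangents miss (z, f z), after scaling by [c]. *)
pose m := Num.min (c * f z - (c * f p + c * u p * (z - p)))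
                  (c * f q + c * u q * (z - q) - c * f z).
have m0 : 0 < m by rewrite lt_min; lra.
have m1 : m <= c * f z - (c * f p + c * u p * (z - p)) by rewrite ge_min lexx.
have m2 : m <= c * f q + c * u q * (z - q) - c * f z by rewrite ge_min lexx orbT.
have cp : 0 < `|c| by rewrite normr_gt0.
(* All slopes lie in [0, 1], so with this radius the change of abscissa and the change of ordinate
   each cost less than half of [m]. *)
exists z, (m / (2 * `|c|)); split => //; [by rewrite ltr_norml; lra|by apply: divr_gt0; lra|].
move=> t y; rewrite !ltr_pdivlMr; [|lra|lra] => tz yz.
have tz' : `|c * (t - z)| * 2 < m by rewrite normrM; lra.
have yz' : `|c * (y - f z)| * 2 < m by rewrite normrM; lra.
have slope s : `|c * u s * (t - z)| * 2 < m.
  apply: le_lt_trans tz'; rewrite ler_pM2r// mulrAC normrM ler_piMr//.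
  by rewrite ger0_norm ?staircase_le1 ?staircase_ge0.
pose h s := c * (f s + u s * (t - s)).
have ch : continuous h.
  move=> s; apply: cvgM; first exact: cvg_cst.
  apply: cvgD; first exact: (is_derive_continuous R f u df).
  by apply: cvgM; [exact: cu|apply: cvgB; [exact: cvg_cst|exact: cvg_id]].
have hK s : ~ variation_set R u s -> locally_constant_at R h s.
  move=> /notin_variation_set/(tangent_locally_constant R f u t s df) [d d0 hd].
  by exists d => // w /hd; rewrite /h => ->.
have hpq : h p < c * y < h q.
  have half w : `|w| * 2 < m -> - m < 2 * w < m.
    by have := ler_norm w; have := ler_norm (- w); rewrite normrN; lra.
  have sp := half _ (slope p); have sq := half _ (slope q); have sy := half _ yz'.
  rewrite /h.
  have -> : c * (f p + u p * (t - p)) =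
    c * f p + c * u p * (z - p) + c * u p * (t - z) by ring.
  have -> : c * (f q + u q * (t - q)) =
    c * f q + c * u q * (z - q) + c * u q * (t - z) by ring.
  have -> : c * y = c * f z + c * (y - f z) by ring.
  lra.
have [s sp [Ks hs]] := IVT_variation R h _ p q (c * y) ch hK pq hpq.
exists s; split => //; first by rewrite ltr_norml; lra.
exact: (mulfI c0).
Qed.

(** * Linearly continuous functions and the contradiction along tangents *)

Lemma linearly_continuous_line (R : realType) (g : R * R -> R) (p v : R * R) :
  linearly_continuous g -> v != (0, 0) ->
  continuous (fun t : R => g (p.1 + t * v.1, p.2 + t * v.2)).
Proof.
move=> gl v0 t; have cg := gl p v v0.
set P := (p.1 + t * v.1, p.2 + t * v.2).
have LP : affine_line p v P by exists t.
have : g @ within (affine_line p v) (nbhs P) --> g P.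
  by rewrite nbhs_subspace_in//; exact: cg.
move=> gP B /gP hB.
have cl : (fun s : R => (p.1 + s * v.1, p.2 + s * v.2)) @ t --> P.
  have line (a b : R) : a + s * b @[s --> t] --> a + t * b.
    apply: cvgD; first exact: cvg_cst.
    by apply: cvgM; [exact: cvg_id|exact: cvg_cst].
  exact: (cvg_pair (line _ _) (line _ _)).
have /nbhs_ballP[d d0 hd] : nbhs t _ := cl _ hB.
by apply/nbhs_ballP; exists d => // s /hd; apply; exists s.
Qed.

Lemma linearly_continuous_slope (R : realType) (g : R * R -> R) (x y b : R) :
  linearly_continuous g -> continuous (fun t : R => g (t, y + b * (t - x))).
Proof.
move=> gl.
have -> : (fun t : R => g (t, y + b * (t - x))) =
    (fun t : R => g ((0 : R, y - b * x).1 + t * (1 : R, b).1, (0 : R, y - b * x).2 + t * (1 : R, b).2)).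
  by apply/funext => t /=; congr (g (_, _)); ring.
by apply: linearly_continuous_line => //; rewrite xpair_eqE oner_eq0.
Qed.

Lemma linearly_continuous_vertical (R : realType) (g : R * R -> R) (x : R) :
  linearly_continuous g -> continuous (fun t : R => g (x, t)).
Proof.
move=> gl.
have -> : (fun t : R => g (x, t)) =
    (fun t : R => g ((x, 0 : R).1 + t * (0 : R, 1 : R).1, (x, 0 : R).2 + t * (0 : R, 1 : R).2)).
  by apply/funext => t /=; congr (g (_, _)); ring.
by apply: linearly_continuous_line => //; rewrite xpair_eqE oner_eq0 andbF.
Qed.

Lemma not_continuous_pair (R : realType) (g : R * R -> R) (x y : R) :
  ~ {for (x, y), continuous g} -> exists2 e : R, 0 < e &
    forall d, 0 < d -> exists s t, [/\ `|s - x| < d, `|t - y| < d &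
      e <= `|g (s, t) - g (x, y)|].
Proof.
move=> ng; apply: contrapT => h; apply: ng; apply/cvgrPdist_lt => e e0.
apply: contrapT => h2; apply: h; exists e => // d d0; apply: contrapT => h3.
apply: h2; apply/(@nbhs_ballP R (R * R)%type); exists d => // -[s t] [] /=.
rewrite -!ball_normE /= => xs yt; rewrite ltNge; apply/negP => egst.
by apply: h3; exists s, t; rewrite -(distrC x) -(distrC y) -(distrC (g (x, y))).
Qed.

Lemma continuous_dist (R : realType) (h : R -> R) (x e : R) :
  {for x, continuous h} -> 0 < e ->
  exists2 d : R, 0 < d & forall t, `|t - x| < d -> `|h t - h x| < e.
Proof.
move=> /cvgrPdist_lt ch e0; have /nbhs_ballP[d /= d0 hd] := ch e e0.
exists d => // t tx; rewrite distrC; apply: hd.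
by rewrite -ball_normE /= distrC.
Qed.

Lemma graph_staircase_continuity_point (R : realType) (f : R -> R) (g : R * R -> R) :
  (forall x : R, is_derive x 1 f (staircase R x)) -> linearly_continuous g ->
  exists2 x, variation_set R (staircase R) x & {for (x, f x), continuous g}.
Proof.
move=> df gl; apply: contrapT => nog.
set u := staircase R in df nog *; set K := variation_set R u in nog *.
pose e k : R := (2 / 3) ^+ k.
have e0 k : 0 < e k by apply: exprn_gt0; lra.
have cf : continuous f := is_derive_continuous R f _ df.
(* Oscillation, half-length (in abscissa) of the tangent segment and central value are restricted to
   powers of 2/3 and rationals, which makes the family countable. *)
pose A (i : nat * nat * rat) := let: (k, n, c) := i in [set p |
  (forall d, 0 < d -> exists s t, [/\ `|s - p| < d, `|t - f p| < d &
      e k <= `|g (s, t) - g (p, f p)|]) /\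
  (forall s, `|s - p| < e n -> `|g (s, f p + u p * (s - p)) - ratr c| < e k / 4)].
have KA p : K p -> exists i, A i p.
  move=> Kp; have [r r0 hr] : exists2 r : R, 0 < r & forall d, 0 < d ->
      exists s t, [/\ `|s - p| < d, `|t - f p| < d & r <= `|g (s, t) - g (p, f p)|].
    by apply: not_continuous_pair => gp; apply: nog; exists p.
  have [k kr] := geometric_small R 1 r r0; rewrite mul1r -/(e k) in kr.
  have [c] := @rat_in_itvoo R (g (p, f p) - e k / 8) (g (p, f p) + e k / 8)
    ltac:(have := e0 k; lra).
  rewrite in_itv /= => hc.
  have [d d0 hd] := continuous_dist R _ p (e k / 8)
    (linearly_continuous_slope R g p (f p) (u p) gl p) ltac:(have := e0 k; lra).
  have [n nd] := geometric_small R 1 d d0; rewrite mul1r -/(e n) in nd.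
  exists (k, n, c); split.
    move=> d' d'0; have [s [t [sp tp st]]] := hr d' d'0.
    by exists s, t; split => //; lra.
  move=> s sp; have := hd s (lt_trans sp nd).
  by rewrite subrr mulr0 addr0 !ltr_norml; lra.
have [[[k n] c] [x [r [Kx r0 hx]]]] := closed_baire R _ K A
  (closed_variation_set R u) (variation_staircase_neq0 R) KA.
(* The path from [t] to [a] through [z], [x] and [q] has four legs, each shorter than [r']; hence
   [t] lies within the controlled segment of the tangent at [a]. *)
pose r' := Num.min r (e n / 4).
have r'0 : 0 < r' by rewrite lt_min r0 divr_gt0.
have r'r : r' <= r by rewrite ge_min lexx.
have r'n : r' <= e n / 4 by rewrite ge_min lexx orbT.
have [z [d [Kz zx d0 hz]]] := staircase_tangents_cover R f x r' df Kx r'0.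
pose d' := Num.min d r'.
have d'0 : 0 < d' by rewrite lt_min d0.
have d'd : d' <= d by rewrite ge_min lexx.
have d'r : d' <= r' by rewrite ge_min lexx orbT.
have near_c t y : `|t - z| < d' -> `|y - f z| < d' -> `|g (t, y) - ratr c| <= e k / 4.
  move=> tz yz; rewrite leNgt; apply/negP => gty.
  have [q [Kq qx qy]] := hz t y ltac:(lra) ltac:(lra).
  have [d1 d10 h1] := continuous_dist R _ y (`|g (t, y) - ratr c| - e k / 4)
    (linearly_continuous_vertical R g t gl y) ltac:(lra).
  (* The tangent at [q] hits (t, y), but the bound is known only at points [a] of the dense set. The
     tangent at a nearby [a] passes over [t] at a height close to [y], and continuity on the
     vertical line transfers the bound. *)
  have ch : continuous (fun s => f s + u s * (t - s)).
    move=> s; apply: cvgD; first exact: cf.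
    apply: cvgM; first exact: staircase_continuous.
    by apply: cvgB; [exact: cvg_cst|exact: cvg_id].
  have [d2 d20 h2] := continuous_dist R _ q d1 (ch q) d10.
  have [a [_ Aa] aq] := hx q (Num.min d2 r') Kq ltac:(lra) ltac:(by rewrite lt_min d20).
  move: aq; rewrite lt_min => /andP[aq1 aq2].
  have ta : `|t - a| < e n.
    by move: tz zx qx aq2; rewrite !ltr_norml; lra.
  have := Aa t ta; have := h2 a aq1; rewrite qy => /h1.
  have := ler_distD (g (t, f a + u a * (t - a))) (g (t, y)) (ratr c).
  by rewrite [`|g (t, y) - g _|]distrC; lra.
(* One half of [d'] goes from [z] to [a], the other from [a] to the oscillation point. Both values
   of [g] are then within a quarter of [e k] from [c], too close for an oscillation of [e k]. *)
have [d1 d10 h1] := continuous_dist R _ z (d' / 2) (cf z) ltac:(lra).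
have [a [hA _] az] := hx z (Num.min d1 (d' / 2)) Kz ltac:(lra)
  ltac:(by rewrite lt_min d10; lra).
move: az; rewrite lt_min => /andP[az1 az2].
have [s [t [sa ta]]] := hA (d' / 2) ltac:(lra).
have := near_c s t; have := near_c a (f a); have := h1 a az1; have := e0 k.
move: az2 sa ta; rewrite !ltr_norml => az2 sa ta ek fa.
rewrite !ler_norml => /(_ ltac:(lra) ltac:(lra)) g1 /(_ ltac:(lra) ltac:(lra)) g2.
by rewrite leNgt ltr_norml => /negP; apply; lra.
Qed.

(** * Topology of the graph over K, and the conclusion *)

Lemma closed_graph_on (R : realType) (f : R -> R) (K : set R) :
  continuous f -> closed K -> closed (graph_on K f).
Proof.
move=> cf cK.
have -> : graph_on K f = (fun p => p.1) @^-1` K `&` (fun p => p.2 - f p.1) @^-1` [set 0].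
  apply/seteqP; split => [_ [x Kx <-]|[x y] /= [Kx /subr0_eq ->]].
    by split => //=; rewrite subrr.
  by exists x.
apply: closedI; apply: preimage_closed => //.
- by move=> [a b] _; exact: cvg_fst.
- move=> [a b] _; apply: cvgB; first exact: cvg_snd.
  by apply: (@continuous_comp _ _ _ fst f); [exact: cvg_fst|exact: cf].
Qed.

(** The graph over [K] is its own closure. A relative interior point would pull back along the
    continuous map y -> (y, f y) to a point of [K] near which all points of [A] belong to [K]. *)
Lemma nowhere_dense_in_graph_on (R : realType) (f : R -> R) (A K : set R) :
  continuous f -> closed K -> K `<=` A ->
  (forall x e, K x -> 0 < e -> exists y, [/\ A y, `|y - x| < e & ~ K y]) ->
  nowhere_dense_in (graph_on A f) (graph_on K f).
Proof.
move=> cf cK KA gap.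
have sub : graph_on K f `<=` graph_on A f by move=> _ [x Kx <-]; exists x => //; exact: KA.
rewrite /nowhere_dense_in /nowhere_dense closure_subspaceW//.
rewrite -(closure_id _).1; last exact: closed_graph_on.
rewrite (setIidl sub) -subset0 => p ip.
have [x Kx xp] := interior_subset ip.
move: ip; rewrite /interior /= -xp => ip.
have : within (graph_on A f) (nbhs (x, f x)) (graph_on K f).
  rewrite nbhs_subspace_in; first exact: ip.
  by exists x => //; exact: KA.
rewrite /within /= => nK.
have cg : (fun y => (y, f y)) @ x --> (x, f x) by exact: (cvg_pair cvg_id (cf x)).
have /nbhs_ballP[e /= e0 he] : nbhs x _ := cg _ nK.
have [y [Ay yx nKy]] := gap x e Kx e0.
have [|//|w Kw [wy _]] := he y _ _; last by rewrite -wy in nKy.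
- by rewrite -ball_normE /= distrC.
- by exists y.
Qed.

Theorem theorem3p4 (R : realType) :
  exists (f : R -> R) (M : set (R * R)),
    [/\ C1_itv 0 1 f,
        M `<=` graph_on `[0, 1] f,
        closed M,
        nowhere_dense_in (graph_on `[0, 1] f) M &
        ~ exists g : R * R -> R,
            linearly_continuous g /\
            (forall p, M p -> ~ {for p, continuous g})].
Proof.
have [f df] := antiderivative R (staircase R) (staircase_continuous R) (staircase_le0 R).
have cf : continuous f := is_derive_continuous R f _ df.
set K := variation_set R (staircase R).
have K01 : K `<=` `[0, 1] by move=> x /variation_staircase_itv; rewrite /= in_itv.
have cK : closed K := closed_variation_set R (staircase R).
exists f, (graph_on K f); split.
- exact: is_derive_C1_itv (staircase_continuous R) df.
- by move=> _ [x Kx <-]; exists x => //; exact: K01.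
- exact: closed_graph_on.
- apply: nowhere_dense_in_graph_on => // x e Kx e0.
  have [y [y01 yx nKy]] := variation_staircase_gap R x e Kx e0.
  by exists y; rewrite /= in_itv.
- move=> [g [gl gM]].
  have [x Kx gx] := graph_staircase_continuity_point R f g df gl.
  by apply: (gM (x, f x)) gx; exists x.
Qed.
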